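(* Let $R$ be a ring. Then $R$ is $\eta$-elementary if and only if $R^2=\{0\}$ (that is, $rs=0$ for all $r,s\in R$) and there is a prime $p$ such that $(R,+)\cong C_p\times C_p$. Moreover, in this case $\eta(R)=p+1$.
   Context: Rings are associative, but not necessarily commutative and not necessarily unital. $C_p$ denotes the cyclic group of order $p$. An ideal of $R$ is proper if it is different from $R$. For a ring $R$, $\eta(R)$ is the minimum cardinality of a collection of proper two-sided ideals of $R$ whose set-theoretic union equals $R$, and $\eta(R)=\infty$ if no such collection exists. A ring $R$ is $\eta$-elementary if $R$ is the union of finitely many proper two-sided ideals and $\eta(R)<\eta(R/I)$ for every nonzero two-sided ideal $I$ of $R$ (where every integer is less than $\infty$). *)

(* Defs.v *)
From HB Require Import structures.
From mathcomp Require Import all_boot all_order all_algebra.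
From mathcomp Require Import generic_quotient ring_quotient.
From mathcomp Require Import boolp classical_sets functions cardinality.

Set Implicit Arguments.
Unset Strict Implicit.
Unset Printing Implicit Defensive.

Import GRing.Theory.

Local Open Scope classical_set_scope.
Local Open Scope card_scope.
Local Open Scope quotient_scope.
Local Open Scope ring_scope.

(* MathComp's ring structures are all unital, hence a separate structure for
   associative rings that need be neither commutative nor unital. *)
HB.mixin Record Zmodule_isRng R of GRing.Zmodule R := {
  rmul : R -> R -> R;
  rmulA : associative rmul;
  rmulDl : left_distributive rmul +%R;
  rmulDr : right_distributive rmul +%R
}.

#[short(type="rngType")]
HB.structure Definition Rng := {R of GRing.Zmodule R & Zmodule_isRng R}.

Notation "x ** y" := (rmul x y) (at level 40, left associativity) : ring_scope.

Section RngTheory.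
Variable R : rngType.
Implicit Types x y z : R.

Lemma rmul0l x : 0 ** x = 0.
Proof. by apply: (addrI (0 ** x)); rewrite -rmulDl !addr0. Qed.

Lemma rmul0r x : x ** 0 = 0.
Proof. by apply: (addrI (x ** 0)); rewrite -rmulDr !addr0. Qed.

Lemma rmulNl x y : (- x) ** y = - (x ** y).
Proof. by apply: (addIr (x ** y)); rewrite -rmulDl !addNr rmul0l. Qed.

Lemma rmulNr x y : x ** (- y) = - (x ** y).
Proof. by apply: (addIr (x ** y)); rewrite -rmulDr !addNr rmul0r. Qed.

Lemma rmulBl x y z : (x - y) ** z = x ** z - y ** z.
Proof. by rewrite rmulDl rmulNl. Qed.

Lemma rmulBr x y z : z ** (x - y) = z ** x - z ** y.
Proof. by rewrite rmulDr rmulNr. Qed.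

End RngTheory.

Section Ideals.
Variable R : rngType.

Definition is_ideal (I : set R) : Prop :=
  [/\ I 0,
      forall x y, I x -> I y -> I (x - y) &
      forall r x, I x -> I (r ** x) /\ I (x ** r)].

Definition is_proper_ideal (I : set R) : Prop := is_ideal I /\ I <> setT.

Record ideal := Ideal { ideal_set :> set R; idealP : is_ideal ideal_set }.

Definition ideal_cover (C : set (set R)) : Prop :=
  C `<=` is_proper_ideal /\ \bigcup_(I in C) I = setT.

End Ideals.

(* The quotient ring R / I: the library's quotient of the additive group by I,
   with the multiplication induced from R. *)
Section Quotient.
Variables (R : rngType) (I : ideal R).

Definition ideal_pred : {pred R} := fun x => `[< ideal_set I x >].

Lemma ideal_predP x : reflect (ideal_set I x) (x \in ideal_pred).
Proof. exact: asboolP. Qed.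

Lemma ideal_zmod_closed : zmod_closed ideal_pred.
Proof.
have [I0 IB _] := idealP I; split; first exact/ideal_predP.
by move=> x y /ideal_predP Ix /ideal_predP Iy; apply/ideal_predP/IB.
Qed.

HB.instance Definition _ :=
  GRing.isZmodClosed.Build R ideal_pred ideal_zmod_closed.

Definition rng_quot : Type := Quotient.quot ideal_pred.

HB.instance Definition _ := GRing.Zmodule.on rng_quot.
HB.instance Definition _ := EqQuotient.on rng_quot.

Lemma pi_rng_add : {morph \pi_rng_quot : x y / x + y >-> x + y}.
Proof. exact: Quotient.pi_add. Qed.

Lemma rng_quot_eqP x y : reflect (ideal_set I (x - y)) (x == y %[mod rng_quot]).
Proof. by rewrite -Quotient.idealrBE; exact: ideal_predP. Qed.

Definition rng_quot_mul : rng_quot -> rng_quot -> rng_quot :=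
  lift_op2 rng_quot (@rmul R).

Lemma pi_rmul : {morph \pi_rng_quot : x y / x ** y >-> rng_quot_mul x y}.
Proof.
have [_ IB IM] := idealP I.
have ID x y : ideal_set I x -> ideal_set I y -> ideal_set I (x + y).
  move=> Ix Iy; rewrite -[y]opprK; apply: (IB) => //.
  by rewrite -sub0r; apply: IB => //; case: (idealP I).
move=> x y; unlock rng_quot_mul; apply/eqP/rng_quot_eqP.
set x' := repr _; set y' := repr _.
have Ix : ideal_set I (x - x') by apply/rng_quot_eqP; rewrite reprK.
have Iy : ideal_set I (y - y') by apply/rng_quot_eqP; rewrite reprK.
rewrite -[x ** y](addrNK (x ** y')) -rmulBr -addrA -rmulBl.
by apply: ID; [exact: (IM x _ Iy).1 | exact: (IM y' _ Ix).2].
Qed.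

Lemma rng_quot_mulA : associative rng_quot_mul.
Proof.
by move=> x y z; rewrite -[x]reprK -[y]reprK -[z]reprK -!pi_rmul rmulA.
Qed.

Lemma rng_quot_mulDl : left_distributive rng_quot_mul +%R.
Proof.
move=> x y z; rewrite -[x]reprK -[y]reprK -[z]reprK.
by rewrite -pi_rng_add -!pi_rmul -pi_rng_add rmulDl.
Qed.

Lemma rng_quot_mulDr : right_distributive rng_quot_mul +%R.
Proof.
move=> x y z; rewrite -[x]reprK -[y]reprK -[z]reprK.
by rewrite -pi_rng_add -!pi_rmul -pi_rng_add rmulDr.
Qed.

HB.instance Definition _ := Zmodule_isRng.Build rng_quot
  rng_quot_mulA rng_quot_mulDl rng_quot_mulDr.

End Quotient.

(* Cardinals extended by a value oo for "no such collection".  A cardinal is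
   represented by a set having it, so that cardinals are to be compared with
   ecard_eq and ecard_lt below, never with the Leibniz equality. *)
Inductive ecard : Type :=
| ECard (T : Type) of set T
| EInfty.

Definition ecard_lt (k l : ecard) : Prop :=
  match k, l with
  | ECard T A, ECard U B => A #<= B /\ ~ (B #<= A)
  | ECard T A, EInfty => True
  | EInfty, _ => False
  end.

Definition ecard_eq (k l : ecard) : Prop :=
  match k, l with
  | ECard T A, ECard U B => A #= B
  | EInfty, EInfty => True
  | _, _ => False
  end.

Definition ecard_of_nat (n : nat) : ecard := ECard `I_n.

(* The cardinals are well ordered: any nonempty family F of sets has a member
   of least cardinality.  Take a maximal set X of choice functions for F that
   are pairwise distinct at every member of F; by maximality, the evaluation
   of X at some member is surjective. *)
Lemma card_min (T : Type) (F : set (set T)) : F !=set0 ->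
  exists2 C, F C & forall D, F D -> C #<= D.
Proof.
move=> [C0 FC0].
pose P (X : set (set T -> T)) :=
  (forall g, X g -> forall D, F D -> D (g D)) /\
  (forall g h, X g -> X h -> forall D, F D -> g D = h D -> g = h).
have [G GP Gtot|X [[XF Xinj] Xmax]] := @Zorn_bigcup _ P.
  split=> [g [X GX Xg]|g h [X GX Xg] [Y GY Yh]]; first exact: (GP _ GX).1.
  by have [XY|YX] := Gtot _ _ GX GY;
    [apply: (GP _ GY).2 => //; exact: XY|apply: (GP _ GX).2 => //; exact: YX].
have [C FC Csurj] : exists2 C, F C & forall y, C y -> exists2 g, X g & g C = y.
  apply: contrapT => nC.
  have /choice[y yP] (D : set T) :
      exists y, F D -> D y /\ forall g, X g -> g D <> y.
    have [FD|nFD] := pselect (F D); last first.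
      have [t0 _] : exists t0 : T, True.
        have [[t t_]|C0_0] := pselect (C0 !=set0); first by exists t.
        case: nC; exists C0 => // y C0y.
        by case: C0_0; exists y.
      by exists t0.
    apply: contrapT => ny; case: nC; exists D => // y Dy.
    apply: contrapT => nX; case: ny; exists y => _; split=> // g Xg gy.
    by apply: nX; exists g.
  have nXy : ~ X y by move=> /(yP _ FC0).2; apply.
  case: (Xmax (X `|` [set y])).
    split; first by move=> g Xg; left.
    by move=> XyX; apply: nXy; apply: XyX; right.
  split=> [g [Xg|->] D FD|g h [Xg|->] [Xh|->] D FD //].
  - exact: (XF _ Xg _ FD).
  - exact: (yP _ FD).1.
  - exact: (Xinj _ _ Xg Xh _ FD).
  - by move=> /((yP _ FD).2 _ Xg).
  - by move=> /esym/((yP _ FD).2 _ Xh).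
exists C => // D FD.
have CX : C #<= X.
  have <- : (fun g => g C) @` X = C.
    apply/seteqP; split=> [_ [g Xg <-]|y /Csurj[g Xg gy]]; first exact: (XF _ Xg _ FC).
    by exists g.
  exact: card_image_le.
apply: (card_le_trans CX).
have := @inj_card_eq _ _ X (fun g => g D).
move=> /(_ _)/card_eqPle[|_ XD].
  by move=> g h /set_mem Xg /set_mem Xh; exact: (Xinj _ _ Xg Xh _ FD).
apply: (card_le_trans XD); apply: subset_card_le => _ [g Xg <-]; exact: (XF _ Xg _ FD).
Qed.

(* k is the least cardinality of a cover of R by proper ideals, or oo. *)
Definition is_eta (R : rngType) (k : ecard) : Prop :=
  match k with
  | ECard T A => (exists2 C : set (set R), ideal_cover C & C #= A) /\
                 (forall D : set (set R), ideal_cover D -> A #<= D)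
  | EInfty => ~ exists C : set (set R), ideal_cover C
  end.

Lemma eta_exists (R : rngType) : exists k, is_eta R k.
Proof.
have [|nC] := pselect (exists C : set (set R), ideal_cover C); last first.
  by exists EInfty.
by move=> /card_min[C RC Cmin]; exists (ECard C); split=> //; exists C.
Qed.

Definition eta (R : rngType) : ecard := sval (cid (eta_exists R)).

Lemma etaP (R : rngType) : is_eta R (eta R).
Proof. exact: svalP (cid (eta_exists R)). Qed.

Definition eta_elementary (R : rngType) : Prop :=
  (exists2 C : set (set R), ideal_cover C & finite_set C) /\
  (forall I : ideal R, ideal_set I <> [set 0] ->
     ecard_lt (eta R) (eta (rng_quot I))).

Definition additive_iso (U V : zmodType) : Prop :=
  exists f : {additive U -> V}, bijective f.

(* Main.v *)
From HB Require Import structures.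
Require Import Defs.
From mathcomp Require Import all_boot all_order all_algebra.
From mathcomp Require Import generic_quotient finmap ring.
From mathcomp Require Import boolp classical_sets functions cardinality.

Set Implicit Arguments.
Unset Strict Implicit.
Unset Printing Implicit Defensive.

Import GRing.Theory.

Local Open Scope classical_set_scope.
Local Open Scope card_scope.
Local Open Scope quotient_scope.
Local Open Scope ring_scope.

(** Let [R] be eta-elementary and take a cover [C] of least cardinality by proper
ideals. The images of its members cover the quotient of [R] by their
intersection, with no more members than [C] has, so eta-elementarity forces the
intersection of every least cover to be zero (elementary_bigcap0). Least covers
being irredundant, this makes [R] finite, by an argument of B. H. Neumann
(irredundant_bigcap_finite). So each member of [C] may be enlarged to a maximal
ideal, which gives a least cover [D] by maximal ideals.

The main tool is that no member [M] of an irredundant cover by maximal ideals is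
independent of the others: the intersection of the others is contained in [M]
(irredundant_maximal), as otherwise the Chinese remainder theorem would produce
an element avoiding every member. It is used twice.
- If [M] does not contain all products, then [M] is prime, and the other maximal
  ideals, none of which lies in [M], cannot have their intersection inside [M].
  So every product lies in every member, hence is zero.
- Now ideals are just additive subgroups, and every [R/M] has prime order. Were
  this prime [p] met for one member [M] only, the intersection of the others
  would contain [N R] for some [N] coprime to [p], while [M] contains [p R],
  giving [M = R]. So the least prime [p] occurring as such an order occurs for two
  members [M1] and [M2], the kernels of functionals [f] and [g] from [R] to Z/p.

Since all these primes are at least [p], the cover [D] has at least [p + 1]
members (irredundant_card_ge). On the other hand the [p + 1] kernels of [g] and
of [f - k g], for [k] in Z/p, cover [R] too: at a point where [g] does not vanish
take for [k] the ratio of [f] to [g]. So this pencil is also a least cover, its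
intersection, which is that of [M1] and [M2], is zero, and [(f, g)] identifies
[R] with the product of two copies of Z/p.

Conversely, let [R] have zero multiplication and be a plane over Z/p. The two
bounds above show that its eta is [p + 1]. A proper ideal containing [x <> 0] is
contained in the line through [x]; hence no family of proper ideals all
containing [x] covers [R], and the quotients by nonzero ideals have infinite
eta. *)

(** * Finite families of sets *)

Section FiniteSets.
Variable T : choiceType.
Implicit Types A S : set T.

Lemma fset_set_ltn_card A S : finite_set A -> S `<=` A -> ~ A `<=` S ->
  (#|` fset_set S| < #|` fset_set A|)%N.
Proof.
move=> Afin SA AS; have Sfin := sub_finite_set SA Afin.
apply: fproper_ltn_card; rewrite fproperE; apply/andP; split.
  by rewrite -fset_set_sub.
by apply/negP; rewrite -fset_set_sub.
Qed.

Lemma card_le_subset_eq A S : finite_set A -> S `<=` A -> A #<= S -> A `<=` S.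
Proof.
move=> Afin SA AleS; apply: contrapT => /(fset_set_ltn_card Afin SA).
have Sfin := sub_finite_set SA Afin.
have [n An] := (finite_setP A).1 Afin.
rewrite (card_fset_set An) ltnNge => /negP[]; apply: leq_card_fset_set => //.
by rewrite -(card_le_eql An).
Qed.

(** Downward induction: from a property of all the larger subsets of [A] to the
property of [S]. *)
Lemma finite_subset_ind A (P : set T -> Prop) : finite_set A ->
  (forall S, S `<=` A ->
     (forall S', S `<=` S' -> ~ S' `<=` S -> S' `<=` A -> P S') -> P S) ->
  forall S, S `<=` A -> P S.
Proof.
move=> Afin IH S; have [n] := ubnP (#|` fset_set A| - #|` fset_set S|)%N.
elim: n S => // n IHn S lenS SA; apply: IH => // S' SS' S'S S'A; apply: IHn => //.
have S'fin := sub_finite_set S'A Afin.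
have lt := fset_set_ltn_card S'fin SS' S'S.
rewrite -ltnS; apply: leq_trans lenS; rewrite ltnS ltn_sub2l//.
by apply: leq_trans lt _; apply: fsubset_leq_card; rewrite -fset_set_sub.
Qed.

Lemma finite_bigcap_closed (P : set T -> Prop) (F : set (set T)) :
  finite_set F -> P setT ->
  (forall A S, P A -> P S -> P (A `&` S)) ->
  (forall A, F A -> P A) -> P (\bigcap_(A in F) A).
Proof.
move=> /finite_seqP[s ->] PT PI Ps; rewrite bigcap_seq big_seq.
by elim/big_ind: _.
Qed.

End FiniteSets.

(** * Ideals and maximal ideals *)

Section IdealClosure.
Variables (R : rngType) (J : set R).
Hypothesis idJ : is_ideal J.
Implicit Types x y r : R.

Lemma ideal0 : J 0. Proof. by case: idJ. Qed.

Lemma idealB x y : J x -> J y -> J (x - y). Proof. by case: idJ => _ + _; apply. Qed.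

Lemma idealN x : J x -> J (- x).
Proof. by rewrite -sub0r; apply: idealB; exact: ideal0. Qed.

Lemma idealD x y : J x -> J y -> J (x + y).
Proof. by move=> Jx Jy; rewrite -[y]opprK; apply/idealB/idealN. Qed.

Lemma idealMn x n : J x -> J (x *+ n).
Proof.
move=> Jx; elim: n => [|n IHn]; first by rewrite mulr0n; exact: ideal0.
by rewrite mulrS; exact: idealD.
Qed.

Lemma idealMl r x : J x -> J (r ** x).
Proof. by case: idJ => _ _ + Jx => /(_ r x Jx)[]. Qed.

Lemma idealMr r x : J x -> J (x ** r).
Proof. by case: idJ => _ _ + Jx => /(_ r x Jx)[]. Qed.

Lemma ideal_subr x y : J y -> J (x - y) -> J x.
Proof. by move=> Jy Jxy; rewrite -(subrK y x); exact: idealD. Qed.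

Lemma ideal_Mn_coprime m n x : (0 < m)%N -> coprime m n ->
  J (x *+ m) -> J (x *+ n) -> J x.
Proof.
move=> m0 /eqP mn Jm Jn; have [a _ /dvdnP[k]] := Bezoutl n m0.
rewrite mn => e; have -> : x = x *+ m *+ k - x *+ n *+ a.
  by rewrite -!mulrnA ![(_ * k)%N]mulnC -e mulrnDr mulnC addrK.
by apply: idealB; exact: idealMn.
Qed.

End IdealClosure.

Section Ideals.
Variable R : rngType.
Implicit Types (J K M : set R) (C D S : set (set R)).

Lemma proper_ideal_notin J : is_proper_ideal J -> exists x, ~ J x.
Proof.
by move=> [_ prJ]; apply/existsNP => JT; apply: prJ; apply/seteqP; split.
Qed.

Definition maximal_ideal M : Prop :=
  is_proper_ideal M /\ forall J, is_proper_ideal J -> M `<=` J -> J `<=` M.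

Definition ideal_sum J K : set R := [set x | exists2 a, J a & K (x - a)].

Lemma is_ideal_sum J K : is_ideal J -> is_ideal K -> is_ideal (ideal_sum J K).
Proof.
move=> idJ idK; split.
- by exists 0; [exact: ideal0|rewrite subr0; exact: ideal0].
- move=> x y [a Ja Kx] [b Jb Ky]; exists (a - b); first exact: idealB.
  have -> : x - y - (a - b) = (x - a) - (y - b).
    by rewrite !opprB addrACA [RHS]addrACA [- y - a]addrC.
  exact: idealB.
- move=> r x [a Ja Kx]; split.
    by exists (r ** a); [exact: idealMl|rewrite -rmulBr; exact: idealMl].
  by exists (a ** r); [exact: idealMr|rewrite -rmulBl; exact: idealMr].
Qed.

Lemma is_ideal_bigcap S : (forall J, S J -> is_ideal J) ->
  is_ideal (\bigcap_(J in S) J).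
Proof.
move=> idS; split=> [J SJ|x y Sx Sy J SJ|r x Sx].
- exact: ideal0 (idS _ SJ).
- by apply: (idealB (idS _ SJ)); [exact: Sx|exact: Sy].
- by split=> J SJ; [apply: (idealMl (idS _ SJ)); exact: Sx
                   |apply: (idealMr (idS _ SJ)); exact: Sx].
Qed.

Lemma is_idealI J K : is_ideal J -> is_ideal K -> is_ideal (J `&` K).
Proof.
move=> idJ idK; split=> [|x y [Jx Kx] [Jy Ky]|r x [Jx Kx]].
- by split; exact: ideal0.
- by split; exact: idealB.
- by split; split; [exact: idealMl|exact: idealMl|exact: idealMr|exact: idealMr].
Qed.

Lemma maximal_ideal_notin M M' : maximal_ideal M -> maximal_ideal M' ->
  M' <> M -> exists2 a, M' a & ~ M a.
Proof.
move=> [prM _] [_ maxM'] M'M; apply: contrapT => na; apply: M'M.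
have sub : M' `<=` M.
  by move=> x M'x; apply: contrapT => nMx; apply: na; exists x.
by apply/seteqP; split=> //; exact: maxM'.
Qed.

(** If [x] lay outside [J + M], that sum would be a proper ideal above [M], so
equal to [M], and [J] would lie in [M]. *)
Lemma maximal_ideal_sum M J x : maximal_ideal M -> is_ideal J ->
  ~ J `<=` M -> ideal_sum J M x.
Proof.
move=> [[idM _] maxM] idJ nJM; apply: contrapT => nx; apply: nJM => a Ja.
have prS : is_proper_ideal (ideal_sum J M).
  by split; [exact: is_ideal_sum|move=> e; apply: nx; rewrite e].
apply: (maxM _ prS).
  by move=> m Mm; exists 0; [exact: ideal0|rewrite subr0].
by exists a => //; rewrite subrr; exact: ideal0.
Qed.

(** Write [r = a] and [s = b] modulo [M], with [a] in [J] and [b] in [K]; then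
[r ** s] is congruent to [a ** b], an element of [J `&` K]. In rings without
unit this needs a product outside [M]. *)
Lemma maximal_ideal_prime M J K r s : maximal_ideal M -> ~ M (r ** s) ->
  is_ideal J -> is_ideal K -> ~ J `<=` M -> ~ K `<=` M -> ~ J `&` K `<=` M.
Proof.
move=> maxM nMrs idJ idK nJ nK JKM; apply: nMrs; have idM := maxM.1.1.
have [a Ja Mra] := maximal_ideal_sum r maxM idJ nJ.
have [b Kb Msb] := maximal_ideal_sum s maxM idK nK.
apply: (ideal_subr idM (y := a ** s)); last by rewrite -rmulBl; exact: idealMr.
apply: (ideal_subr idM (y := a ** b)); last by rewrite -rmulBr; exact: idealMl.
by apply: JKM; split; [exact: idealMr|exact: idealMl].
Qed.

(** Finiteness stands in for the unit that would make the union of a chain of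
proper ideals proper. *)
Lemma maximal_ideal_exists J : finite_set [set: R] -> is_proper_ideal J ->
  exists2 M, maximal_ideal M & J `<=` M.
Proof.
move=> Rfin; pose P J := is_proper_ideal J -> exists2 M, maximal_ideal M & J `<=` M.
suff : P J by [].
apply: (finite_subset_ind (P := P) Rfin) => {J} // J _ IH prJ.
have [maxJ|] := pselect (maximal_ideal J); first by exists J.
move=> /not_andP[//|/existsNP[K /not_implyP[prK /not_implyP[JK nKJ]]]].
have [M maxM KM] := IH K JK nKJ (@subsetT _ _) prK.
by exists M => //; exact: subset_trans KM.
Qed.

(** * Irredundant covers *)

Definition irredundant_cover D : Prop :=
  ideal_cover D /\
  forall S, S `<=` D -> (forall x, exists2 J, S J & J x) -> D `<=` S.

Definition minimal_cover D : Prop :=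
  ideal_cover D /\ forall E : set (set R), ideal_cover E -> D #<= E.

Lemma cover_mem D x : ideal_cover D -> exists2 J, D J & J x.
Proof. by move=> [_ D_]; have : setT x by []; rewrite -D_. Qed.

Lemma irredundant_witness D S : irredundant_cover D -> S `<=` D -> ~ D `<=` S ->
  exists x, forall J, S J -> ~ J x.
Proof.
move=> [_ irrD] SD nDS; apply: contrapT => /forallNP nx; apply: nDS.
apply: irrD => // x; apply: contrapT => nS.
by apply: (nx x) => J SJ Jx; apply: nS; exists J.
Qed.

Lemma minimal_cover_irredundant D : finite_set D -> minimal_cover D ->
  irredundant_cover D.
Proof.
move=> Dfin [covD minD]; split=> // S SD covS.
apply: (card_le_subset_eq Dfin SD); apply: minD; split.
  by move=> J /SD; exact: covD.1.
by apply/seteqP; split=> // x _; have [J SJ Jx] := covS x; exists J.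
Qed.

(** Neumann's argument: by downward induction on [S], the intersection [K] of [S]
is finite. For a proper subfamily [S] pick [x] outside all its members. The
coset [x + K] misses the members of [S], so it is covered by the members [J] of
[D] outside [S]; each of these meets it in the empty set or in a translate of
[K `&` J], which is finite by induction. With [S] empty this says that the whole
ring is finite. *)
Lemma irredundant_bigcap_finite D S : irredundant_cover D -> finite_set D ->
  finite_set (\bigcap_(J in D) J) -> S `<=` D -> finite_set (\bigcap_(J in S) J).
Proof.
move=> irrD Dfin D0.
apply: (finite_subset_ind
  (P := fun S => finite_set (\bigcap_(J in S) J)) Dfin) => {}S SD IH.
have [DS|nDS] := pselect (D `<=` S).
  by have <- : D = S by apply/seteqP.
have [x xS] := irredundant_witness irrD SD nDS.
pose K := \bigcap_(J in S) J.
have idD J : D J -> is_ideal J by move=> DJ; exact: (irrD.1.1 _ DJ).1.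
have idK : is_ideal K by apply: is_ideal_bigcap => J /SD/idD.
have KE : K `<=` \bigcup_(J in D `\` S) [set k | K k /\ J (x + k)].
  move=> k Kk; have [J DJ Jxk] := cover_mem (x + k) irrD.1.
  exists J => //; split=> // SJ; apply: (xS _ SJ).
  by have := idealB (idD _ DJ) Jxk (Kk _ SJ); rewrite addrK.
apply: (sub_finite_set KE); apply: bigcup_finite; first exact: finite_setD.
move=> J [DJ nSJ].
have [[k0 [Kk0 Jk0]]|noK] := pselect (exists k, K k /\ J (x + k)); last first.
  suff -> : [set k | K k /\ J (x + k)] = set0 by exact: finite_set0.
  by apply/seteqP; split=> // k Kk; apply: noK; exists k.
have KJfin : finite_set (\bigcap_(I in S `|` [set J]) I).
  apply: IH; first by move=> I SI; left.
    by move=> /(_ J (or_intror erefl)).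
  by move=> I [/SD//|->].
apply: sub_finite_set (finite_image (fun k => k0 + k) KJfin).
move=> k [Kk Jk]; exists (k - k0); last by rewrite addrC subrK.
move=> I [SI|->]; first exact: (idealB idK Kk Kk0).
have := idealB (idD _ DJ) Jk Jk0.
by rewrite opprD addrACA subrr add0r.
Qed.

(** Let [A] be the intersection of the members other than [M]. If it were not in
[M], then [A + M] would be everything. Take [r] outside all the members other
than [M], and [s] outside [M]: some element is congruent to [r] modulo [A] and
to [s] modulo [M], so it is in no member of the cover. *)
Lemma irredundant_maximal D M : irredundant_cover D -> D M -> maximal_ideal M ->
  \bigcap_(J in D `\ M) J `<=` M.
Proof.
move=> irrD DM maxM; have idD J : D J -> is_ideal J.
  by move=> DJ; exact: (irrD.1.1 _ DJ).1.
set A := \bigcap_(J in _) J; have idA : is_ideal A.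
  by apply: is_ideal_bigcap => J [/idD].
apply: contrapT => nAM.
have [|r rD] := @irredundant_witness D (D `\ M) irrD (@subDsetl _ _ _).
  by move=> /(_ M DM)[_ /(_ erefl)].
have [s nMs] := proper_ideal_notin maxM.1.
have [a Aa Mra] := maximal_ideal_sum (r - s) maxM idA nAM.
(* r - a is r modulo A, and s modulo M *)
have [J DJ Jra] := cover_mem (r - a) irrD.1.
have [JM|nJM] := pselect (J = M).
  apply: nMs; rewrite JM in Jra.
  have := idealB (idD _ DM) Jra Mra.
  by rewrite [r - s - a]addrAC subKr.
have DMJ : (D `\ M) J by split.
by apply: (rD J DMJ); have := idealD (idD _ DJ) Jra (Aa _ DMJ); rewrite subrK.
Qed.

(** With a product outside [M], primality of [M] propagates along finite
intersections: the other members are not in [M], hence neither is their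
intersection, against irredundant_maximal. *)
Lemma irredundant_maximal_null D : irredundant_cover D -> finite_set D ->
  (forall M, D M -> maximal_ideal M) -> forall M, D M -> forall r s, M (r ** s).
Proof.
move=> irrD Dfin maxD M DM r s; apply: contrapT => nMrs.
have [] : is_ideal (\bigcap_(J in D `\ M) J) /\ ~ \bigcap_(J in D `\ M) J `<=` M.
  apply: (finite_bigcap_closed (P := fun J => is_ideal J /\ ~ J `<=` M)).
  - exact: finite_setD.
  - by split; [|move=> TM; apply: nMrs; exact: TM].
  - move=> J K [idJ nJM] [idK nKM]; split; first exact: is_idealI.
    exact: (maximal_ideal_prime (maxD _ DM) nMrs).
  - move=> J [DJ JM]; split=> [|JsubM]; first exact: (maxD _ DJ).1.1.
    have [a Ja nMa] := maximal_ideal_notin (maxD _ DM) (maxD _ DJ) JM.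
    exact/nMa/JsubM.
by move=> _; apply; apply: irredundant_maximal => //; exact: maxD.
Qed.

End Ideals.

(** * Covers of quotient rings *)

Section QuotientCovers.
Variables (R : rngType) (I : ideal R).
Local Notation pi := (\pi_(rng_quot I)).
Implicit Types (J : set R) (K : set (rng_quot I)).

Lemma piB x y : pi (x - y) = pi x - pi y.
Proof. by apply/eqP; rewrite -[_ == _](inj_eq (addIr (pi y))) -pi_rng_add !subrK. Qed.

Lemma pi0 : pi 0 = 0.
Proof. by rewrite -(subrr 0) piB subrr. Qed.

Lemma is_ideal_pi_image J : is_ideal J -> is_ideal (pi @` J).
Proof.
move=> idJ; split.
- by exists 0; [exact: ideal0|exact: pi0].
- by move=> _ _ [x Jx <-] [y Jy <-]; exists (x - y); [exact: idealB|exact: piB].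
- move=> r _ [x Jx <-]; rewrite -[r]reprK; split.
    by exists (repr r ** x); [exact: idealMl|exact: pi_rmul].
  by exists (x ** repr r); [exact: idealMr|exact: pi_rmul].
Qed.

Lemma pi_image_mem J x : is_ideal J -> I `<=` J -> (pi @` J) (pi x) -> J x.
Proof.
move=> idJ IJ [y Jy /esym/eqP/rng_quot_eqP Ixy].
exact: (ideal_subr idJ Jy (IJ _ Ixy)).
Qed.

Lemma ideal_cover_quot (D : set (set R)) : ideal_cover D ->
  (forall J, D J -> I `<=` J) -> ideal_cover [set pi @` J | J in D].
Proof.
move=> covD ID; split.
  move=> _ [J DJ <-]; have [idJ prJ] := covD.1 _ DJ.
  split=> [|piJT]; first exact: is_ideal_pi_image.
  apply: prJ; apply/seteqP; split=> // x _.
  by apply: pi_image_mem (ID _ DJ) _ => //; rewrite piJT.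
apply/seteqP; split=> // z _; rewrite -[z]reprK.
have [J DJ Jz] := cover_mem (repr z) covD.
by exists (pi @` J); [exists J|exists (repr z)].
Qed.

Lemma proper_pi_preimage K : is_proper_ideal K -> is_proper_ideal (pi @^-1` K).
Proof.
move=> [idK prK]; split; last first.
  move=> piKT; apply: prK; apply/seteqP; split=> // z _; rewrite -[z]reprK.
  by have : (pi @^-1` K) (repr z) by rewrite piKT.
split=> [|x y Kx Ky|r x Kx].
- by rewrite /preimage /= pi0; exact: ideal0.
- by rewrite /preimage /= piB; exact: idealB.
- by rewrite /preimage /= !pi_rmul; split; [exact: idealMl|exact: idealMr].
Qed.

Lemma sub_pi_preimage K : is_ideal K -> I `<=` pi @^-1` K.
Proof.
move=> idK x Ix; rewrite /preimage /=; have -> : pi x = pi 0.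
  by apply/eqP/rng_quot_eqP; rewrite subr0.
by rewrite pi0; exact: ideal0.
Qed.

End QuotientCovers.

(** * Least covers *)

Section Eta.
Variable R : rngType.
Implicit Types D : set (set R).

Lemma eta_minimal_cover D : ideal_cover D ->
  exists2 C : set (set R), minimal_cover C & ecard_eq (eta R) (ECard C).
Proof.
move=> covD; have := etaP R; case: (eta R) => [T A|]; last first.
  by case; exists D.
move=> [[C covC CA] Amin]; exists C; last by rewrite /= card_eq_sym.
by split=> // E /Amin; rewrite (card_le_eql CA).
Qed.

(** Otherwise the quotient by this intersection, covered by the images of the
members of [D], would have an eta no larger than that of [R]. *)
Lemma elementary_bigcap0 D : eta_elementary R -> minimal_cover D ->
  \bigcap_(J in D) J = [set 0].
Proof.
move=> [_ ltR] [covD minD].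
have idI : is_ideal (\bigcap_(J in D) J).
  by apply: is_ideal_bigcap => J DJ; exact: (covD.1 _ DJ).1.
apply: contrapT => I0; have := ltR (Ideal idI) I0.
have covQ : ideal_cover [set \pi_(rng_quot (Ideal idI)) @` J | J in D].
  by apply: ideal_cover_quot => // J DJ x; exact.
have := etaP (rng_quot (Ideal idI)); have [C [covC _]] := eta_minimal_cover covD.
case: (eta R) => // T A etaC; case: (eta _) => [U B [_ minB] [_]|nocov _]; last first.
  by apply: nocov; exists [set \pi_(rng_quot (Ideal idI)) @` J | J in D].
apply; rewrite (card_le_eqr etaC); apply: card_le_trans (minB _ covQ) _.
apply: card_le_trans (card_image_le _ _) _; exact: minD.
Qed.

End Eta.

(** * Maximal ideals in rings with zero multiplication *)

Section NullRings.
Variable R : rngType.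
Hypothesis null : forall r s : R, r ** s = 0.
Implicit Types (M : set R) (D : set (set R)).

Lemma maximal_null_cyclic M y : maximal_ideal M -> ~ M y ->
  forall x, exists c : int, M (x - y *~ c).
Proof.
move=> maxM nMy x; pose Zy := [set z | exists c : int, z = y *~ c].
have idZy : is_ideal Zy.
  split=> [|_ _ [c ->] [d ->]|r z _].
  - by exists 0; rewrite mulr0z.
  - by exists (c - d); rewrite mulrzBr.
  - by rewrite !null; split; exists 0; rewrite mulr0z.
have nZyM : ~ Zy `<=` M by move=> /(_ y); apply: contra_not nMy; apply; exists 1.
by have [_ [c ->] Mx] := maximal_ideal_sum x maxM idZy nZyM; exists c.
Qed.

Lemma finite_mulrn0 (x : R) : finite_set [set: R] ->
  exists2 k, (0 < k)%N & x *+ k = 0.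
Proof.
move=> Rfin; apply: contrapT => nk; apply: infinite_nat.
suff inj : injective (fun n => x *+ n).
  rewrite -(preimage_setT (fun n : nat => x *+ n)).
  by apply: finite_preimage => // m n _ _; exact: inj.
move=> m n; wlog mn : m n / (m <= n)%N.
  by move=> wl e; have [/wl|/ltnW/wl] := leqP m n; [exact|move=> ->].
move=> e; apply: contrapT => /eqP; rewrite neq_ltn [(n < m)%N]ltnNge mn orbF => lt.
by apply: nk; exists (n - m)%N; rewrite ?subn_gt0// mulrnBr// e subrr.
Qed.

(** The quotient by [M] is a finite simple abelian group, so it is killed by a
prime. Starting from the order [k] modulo [M] of an element outside [M], that
prime is a factor of [k], and a multiple [y] of the element has this prime as
its order and generates the quotient. *)
Lemma maximal_null_prime M : finite_set [set: R] -> maximal_ideal M ->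
  exists2 p, prime p & forall r, M (r *+ p).
Proof.
move=> Rfin maxM; have idM := maxM.1.1.
have [x nMx] := proper_ideal_notin maxM.1.
have exk : exists k, (0 < k)%N && `[< M (x *+ k) >].
  have [k k0 xk] := finite_mulrn0 x Rfin; exists k; rewrite k0 xk.
  by apply/asboolP; exact: ideal0.
case: (ex_minnP exk) => k /andP[k0 /asboolP Mxk] mink.
have k1 : (1 < k)%N.
  by rewrite ltn_neqAle k0 andbT; apply/eqP => e; move: Mxk; rewrite -e.
exists (pdiv k); first exact: pdiv_prime.
pose y := x *+ (k %/ pdiv k).
have nMy : ~ M y.
  move=> My; have := mink (k %/ pdiv k)%N.
  rewrite divn_gt0 ?pdiv_gt0// dvdn_leq ?pdiv_dvd//=.
  by move=> /(_ (introT (asboolP _) My)); rewrite leqNgt ltn_Pdiv// prime_gt1// pdiv_prime.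
have Myp : M (y *+ pdiv k) by rewrite -mulrnA divnK// pdiv_dvd.
move=> r; have [c Mr] := maximal_null_cyclic maxM nMy r.
apply: (ideal_subr idM (y := y *+ pdiv k *~ c)).
  case: c {Mr} => n; rewrite ?NegzE ?mulrNz; last apply: (idealN idM).
    exact: (idealMn idM).
  exact: (idealMn idM).
by rewrite !pmulrn mulrzAC -mulrzBl -pmulrn; exact: (idealMn idM).
Qed.

(** Otherwise each other member contains [q R] for a prime [q <> p], so their
intersection, hence also [M], contains [N R] with [N] coprime to [p]. *)
Lemma same_residue_prime D M p : irredundant_cover D -> finite_set D ->
  finite_set [set: R] -> (forall M', D M' -> maximal_ideal M') -> D M ->
  prime p -> (forall r, M (r *+ p)) ->
  exists M', [/\ D M', M' <> M & forall r, M' (r *+ p)].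
Proof.
move=> irrD Dfin Rfin maxD DM pr_p Mp; apply: contrapT => noM'.
have [N pN MN] : exists2 N, coprime p N &
    forall r, (\bigcap_(J in D `\ M) J) (r *+ N).
  apply: (finite_bigcap_closed (P := fun J : set R =>
    exists2 N, coprime p N & forall r, J (r *+ N))).
  - exact: finite_setD.
  - by exists 1%N; rewrite ?coprimen1.
  - move=> J K [m pm Jm] [n pn Kn]; exists (m * n)%N; first by rewrite coprimeMr pm.
    by move=> r; split; [rewrite mulnC|]; rewrite mulrnA.
  - move=> M' [DM' M'M]; have [q pr_q M'q] := maximal_null_prime Rfin (maxD _ DM').
    exists q => //; rewrite prime_coprime// dvdn_prime2//; apply/eqP => e.
    by apply: noM'; exists M'; split; rewrite // e.
apply: (maxD _ DM).1.2; apply/seteqP; split=> // r _.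
apply: (ideal_Mn_coprime (maxD _ DM).1.1 (prime_gt0 pr_p) pN (Mp r)).
by apply: (irredundant_maximal irrD DM (maxD _ DM)); exact: MN.
Qed.

End NullRings.

(** * The lower bound *)

(** Let [M] be a member, [u] outside [M], and [v] in [M] but in no other member.
The [p] points [u + n v] are outside [M]; no other member contains two of them,
as it would contain a multiple [d v] with [0 < d < p], hence [v]. So besides [M]
there are at least [p] members. *)
Lemma irredundant_card_ge (R : rngType) (D : set (set R)) p :
  irredundant_cover D ->
  (forall M v d, D M -> (0 < d < p)%N -> M (v *+ d) -> M v) -> `I_p.+1 #<= D.
Proof.
move=> irrD divD; have covD := irrD.1.
have idD J : D J -> is_ideal J by move=> /covD.1[].
have [M DM _] := cover_mem 0 covD.
have [u nMu] := proper_ideal_notin (covD.1 _ DM).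
have [|v Dv] := irredundant_witness irrD (@subDsetl _ D [set M]).
  by move=> /(_ M DM)[_ /(_ erefl)].
have vM J : D J -> J v -> J = M.
  by move=> DJ Jv; apply: contrapT => JM; apply: (Dv J).
have Mv : M v by have [J DJ Jv] := cover_mem v covD; rewrite -(vM J).
have /choice[h hP] n : exists J, D J /\ J (u + v *+ n).
  by have [J DJ Jn] := cover_mem (u + v *+ n) covD; exists J.
have hM n : h n <> M.
  move=> hnM; apply: nMu; have := (hP n).2; rewrite hnM => Mn.
  by have := idealB (idD _ DM) Mn (idealMn (idD _ DM) n Mv); rewrite addrK.
have hlt m n : (m < n < p)%N -> h m <> h n.
  move=> /andP[mn np] e; have [Dm hm] := hP m; have [Dn hn] := hP n.
  apply: (hM n); apply: (vM _ Dn); apply: (divD _ v (n - m)%N Dn).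
    by rewrite subn_gt0 mn (leq_ltn_trans (leq_subr _ _) np).
  have := idealB (idD _ Dn) hn; rewrite -{1}e => /(_ _ hm).
  by rewrite mulrnBr 1?ltnW// opprD addrACA subrr add0r.
pose k n := if n is n'.+1 then h n' else M.
have kinj : {in `I_p.+1 &, injective k}.
  move=> m n /set_mem /= mp /set_mem /= np; case: m n mp np => [|m] [|n]//=.
  - by move=> _ _ /esym/hM.
  - by move=> _ _ /hM.
  rewrite !ltnS => mp np e; case: (ltngtP m n) => [mn|nm|->//].
    by case: (@hlt m n); rewrite ?mn.
  by case: (@hlt n m); rewrite ?nm.
have /card_eqPle[_ kD] := inj_card_eq kinj.
apply: card_le_trans kD _; apply: subset_card_le => _ [[|n] _ <-] //=.
exact: (hP n).1.
Qed.

(** * Functionals to Z/p and the pencil cover *)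

Section ZpFunctionals.
Variables (R : rngType) (p : nat).
Hypotheses (null : forall r s : R, r ** s = 0) (pr_p : prime p).
Implicit Types (f g : {additive R -> 'Z_p}) (x y z : R).

Lemma Zp_char : p \in [char 'Z_p].
Proof. by rewrite inE pr_p /= pchar_Zp ?prime_gt1. Qed.

Lemma Zp_prime_unit (c : 'Z_p) : c != 0 -> c \is a GRing.unit.
Proof.
move=> c0; rewrite -[c]natr_Zp unitZpE ?prime_gt1// prime_coprime//.
by rewrite (dvdn_pcharf Zp_char) natr_Zp.
Qed.

Lemma additive_ideal f g k : is_ideal [set x | f x = g x *+ k].
Proof.
split=> [|x y /= fx fy|r x _] /=; rewrite ?null ?raddf0 ?mul0rn//.
by rewrite !raddfB fx fy mulrnBl.
Qed.

(** Any [y] outside [M] generates the quotient by [M], and the functional sends [x]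
to the class modulo [p] of the [c] such that [x] is [y *~ c] modulo [M]. *)
Lemma maximal_functional (M : set R) : maximal_ideal M ->
  (forall r, M (r *+ p)) -> exists f, forall x, f x = 0 <-> M x.
Proof.
move=> maxM pM; have idM := maxM.1.1.
have [y nMy] := proper_ideal_notin maxM.1.
have Mz (c : int) : M (y *~ c) <-> c%:~R = 0 :> 'Z_p.
  split=> [Mc|/eqP].
    apply/eqP; rewrite -(dvdz_pcharf Zp_char) /dvdz /=; apply: contrapT => /negP.
    rewrite -prime_coprime// => pc; apply: nMy.
    apply: (ideal_Mn_coprime idM (prime_gt0 pr_p) pc (pM _)).
    case: c Mc {pc} => n //= Mc; have := idealN idM Mc.
    by rewrite NegzE mulrNz opprK.
  rewrite -(dvdz_pcharf Zp_char) => /dvdzP[d ->].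
  by rewrite mulrzA; exact: pM.
have /choice[c cP] := maximal_null_cyclic null maxM nMy.
pose F x : 'Z_p := (c x)%:~R.
have FB : zmod_morphism F.
  move=> x z; apply/eqP; rewrite -subr_eq0 -!mulrzBr; apply/eqP/Mz.
  have := idealB idM (idealB idM (cP x) (cP z)) (cP (x - z)).
  congr (M _); rewrite !mulrzBr !opprB.
  rewrite addrC -addrA; congr (_ + _).
  by rewrite !addrA subrK [LHS]addrAC [z - _ - z]addrAC subrr add0r addrC.
pose fM := GRing.isZmodMorphism.Build R 'Z_p F FB.
pose f : {additive R -> 'Z_p} := HB.pack F fM.
exists f => x /=.
split=> [/Mz My|Mx]; first exact: (ideal_subr idM My (cP x)).
by apply/Mz; have := idealB idM Mx (cP x); rewrite subKr.
Qed.

(** The line of slope [k] is numbered [k.+1], and [0] stands for infinite slope, so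
that the [p + 1] lines are indexed by an initial segment of the naturals. *)
Definition pencil_line f g k : set R :=
  [set x | if k is k'.+1 then f x = g x *+ k' else g x = 0].

Definition pencil f g : set (set R) := pencil_line f g @` `I_p.+1.

Lemma pencil_card_le f g : pencil f g #<= `I_p.+1.
Proof. exact: card_image_le. Qed.

(** The element [a] is outside every line of finite slope, and [b] is outside the
remaining one. *)
Lemma pencil_cover f g a b :
  f a != 0 -> g a = 0 -> g b != 0 -> ideal_cover (pencil f g).
Proof.
move=> fa0 ga0 gb0; split.
  move=> _ [[|k] _ <-]; split.
  - have -> : pencil_line f g 0 = [set x | g x = f x *+ 0].
      by apply/funext => x /=; rewrite mulr0n.
    exact: additive_ideal.
  - move=> e; have /eqP : pencil_line f g 0 b by rewrite e.
    by rewrite (negPf gb0).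
  - exact: additive_ideal.
  - move=> e; have : pencil_line f g k.+1 a by rewrite e.
    by rewrite /pencil_line /= ga0 mul0rn => /eqP; rewrite (negPf fa0).
apply/seteqP; split=> // x _; have [gx0|gx0] := eqVneq (g x) 0.
  by exists (pencil_line f g 0) => //; exists 0%N.
pose c := f x / g x.
exists (pencil_line f g c.+1).
  exists c.+1 => //=; rewrite ltnS; have := ltn_ord c.
  by rewrite [X in (_ < X)%N]Zp_cast ?prime_gt1.
by change (f x = g x *+ c); rewrite -mulr_natr natr_Zp mulrC divrK// Zp_prime_unit.
Qed.

End ZpFunctionals.

(** * The plane over Z/p *)

Lemma prime_coprime_lt p q d : prime q -> (p <= q)%N -> (0 < d < p)%N -> coprime q d.
Proof.
move=> pr_q pq /andP[d0 dp]; rewrite prime_coprime//.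
by apply/negP => /(dvdn_leq d0); rewrite leqNgt (leq_trans dp pq).
Qed.

Section Plane.
Variables (R : rngType) (p : nat) (f g : {additive R -> 'Z_p}).
Hypotheses (null : forall r s : R, r ** s = 0) (pr_p : prime p).
Hypothesis fg_inj : forall x, f x = 0 -> g x = 0 -> x = 0.

Lemma plane_collinear x z : x <> 0 -> f x * g z - g x * f z = 0 ->
  exists n, z = x *+ n.
Proof.
move=> x0 /eqP; rewrite subr_eq0 => /eqP det.
suff [c cf cg] : exists2 c : 'Z_p, f x * c = f z & g x * c = g z.
  exists c; apply/eqP; rewrite -subr_eq0; apply/eqP.
  by apply: fg_inj; rewrite raddfB raddfMn -mulr_natr natr_Zp (cf, cg) subrr.
have [fx0|/(Zp_prime_unit pr_p) ufx] := eqVneq (f x) 0; last first.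
  exists (f z / f x); first by rewrite mulrC divrK.
  by rewrite mulrA -det mulrAC divrr// mul1r.
have [gx0|/(Zp_prime_unit pr_p) ugx] := eqVneq (g x) 0; first by case: x0; exact: fg_inj.
exists (g z / g x); last by rewrite mulrC divrK.
by rewrite mulrA det mulrAC divrr// mul1r.
Qed.

(** The determinant [d] of [x] and its argument vanishes on [J]: if [d y] is a unit
for some [y] in [J], then every [r] differs from a multiple of [y] by an element
where [d] vanishes, that is, by a multiple of [x], and [J] is not proper. *)
Lemma plane_ideal_collinear (J : set R) x y : is_proper_ideal J -> x <> 0 -> J x -> J y ->
  exists n, y = x *+ n.
Proof.
move=> [idJ prJ] x0 Jx Jy; apply: (plane_collinear x0).
pose d z := f x * g z - g x * f z; apply/eqP/negPn/negP.
move=> /(Zp_prime_unit pr_p) dy; apply: prJ; apply/seteqP; split=> // r _.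
have [|m e] := @plane_collinear x (r - y *+ (d r / d y : 'Z_p)) x0; last first.
  by apply: (ideal_subr idJ (idealMn idJ (d r / d y : 'Z_p) Jy)); rewrite e; exact: idealMn.
pose c := d r / d y.
have fgB (h : {additive R -> 'Z_p}) : h (r - y *+ c) = h r - h y * c.
  by rewrite raddfB raddfMn -mulr_natr natr_Zp.
rewrite !fgB {fgB}.
have -> : f x * (g r - g y * c) - g x * (f r - f y * c) = d r - c * d y.
  by rewrite /d; ring.
by rewrite divrK// subrr.
Qed.

(** Pulled back to [R], a cover of the quotient consists of proper ideals sharing
some [x <> 0], so every element of [R] is a multiple of [x] and lies in each of
them. *)
Lemma plane_quot_nocover (I : ideal R) : ideal_set I <> [set 0] ->
  ~ exists E : set (set (rng_quot I)), ideal_cover E.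
Proof.
move=> I0 [E covE].
have [x Ix x0] : exists2 x, ideal_set I x & x <> 0.
  apply: contrapT => nx; apply: I0; apply/seteqP; split=> [x Ix|_ ->].
    by apply: contrapT => x0; apply: nx; exists x.
  exact: ideal0 (idealP I).
have EI K : E K -> I `<=` \pi_(rng_quot I) @^-1` K.
  by move=> /covE.1[idK _]; exact: sub_pi_preimage.
have [K EK _] := cover_mem 0 covE.
have prK := proper_pi_preimage (covE.1 _ EK).
apply: prK.2; apply/seteqP; split=> // y _.
have [L EL Ly] := cover_mem (\pi_(rng_quot I) y) covE.
have [n ->] := plane_ideal_collinear (proper_pi_preimage (covE.1 _ EL)) x0 (EI _ EL _ Ix) Ly.
by apply: (idealMn prK.1); exact: EI.
Qed.

(** The pencil gives the upper bound. For the lower bound, every ideal contains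
[v *+ p = 0], so it contains [v] as soon as it contains [v *+ d] with
[0 < d < p]. *)
Lemma plane_eta a b : f a != 0 -> g a = 0 -> g b != 0 ->
  ecard_eq (eta R) (ecard_of_nat p.+1).
Proof.
move=> fa ga gb; have covP := pencil_cover null pr_p fa ga gb.
have [C minC] := eta_minimal_cover covP; have [covC leC] := minC.
case: (eta R) => //= T A etaC; rewrite (card_eql etaC).
have Cp := card_le_trans (leC _ covP) (pencil_card_le f g).
apply/card_eqPle; split=> //; apply: irredundant_card_ge.
  apply: minimal_cover_irredundant => //; apply: card_le_finite Cp _.
  exact: finite_II.
move=> M v d CM dp; apply: (ideal_Mn_coprime (covC.1 _ CM).1 (prime_gt0 pr_p)).
  exact: prime_coprime_lt dp.
suff -> : v *+ p = 0 by exact: ideal0 (covC.1 _ CM).1.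
have p0 (c : 'Z_p) : c *+ p = 0 by rewrite -mulr_natr pchar_Zp ?mulr0// prime_gt1.
by apply: fg_inj; rewrite raddfMn.
Qed.

End Plane.

(** * The characterization *)

Lemma elementary_plane (R : rngType) : eta_elementary R ->
  (forall r s : R, r ** s = 0) /\
  (exists p : nat, prime p /\ additive_iso R ('Z_p * 'Z_p)%type).
Proof.
move=> elR; have [[C0 covC0 C0fin] _] := elR.
have [C minC _] := eta_minimal_cover covC0; have [covC leC] := minC.
have Cfin := card_le_finite (leC _ covC0) C0fin.
have irrC := minimal_cover_irredundant Cfin minC.
have Rfin : finite_set [set: R].
  (* the whole ring is the intersection of the empty subfamily *)
  rewrite -(bigcap_set0 (fun J : set R => J)).
  apply: (irredundant_bigcap_finite irrC) => //.
  by rewrite (elementary_bigcap0 elR minC); exact: finite_set1.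
have /choice[m mP] (J : set R) :
    exists M, is_proper_ideal J -> maximal_ideal M /\ J `<=` M.
  have [/(maximal_ideal_exists Rfin)[M maxM JM]|nJ] := pselect (is_proper_ideal J).
    by exists M.
  by exists J.
(* D is again a cover, with no more members than the least cover C *)
pose D := m @` C.
have maxD M : D M -> maximal_ideal M.
  by move=> [J CJ <-]; exact: (mP J (covC.1 _ CJ)).1.
have covD : ideal_cover D.
  split=> [M /maxD[]//|]; apply/seteqP; split=> // x _.
  have [J CJ Jx] := cover_mem x covC; exists (m J); first by exists J.
  exact: (mP J (covC.1 _ CJ)).2.
have DC : D #<= C by exact: card_image_le.
have minD : minimal_cover D by split=> // E /leC; exact: card_le_trans.
have Dfin := card_le_finite DC Cfin.
have irrD := minimal_cover_irredundant Dfin minD.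
have null (r s : R) : r ** s = 0.
  suff : (\bigcap_(M in D) M) (r ** s) by rewrite (elementary_bigcap0 elR minD).
  by move=> M DM; exact: (irredundant_maximal_null irrD).
split=> //.
(* the primes p such that R / M is killed by p for some M in D *)
pose resp p := prime p && `[< exists2 M, D M & forall r, M (r *+ p) >].
have exp : exists p, resp p.
  have [M DM _] := cover_mem 0 covD.
  have [p pr_p Mp] := maximal_null_prime null Rfin (maxD _ DM).
  by exists p; rewrite /resp pr_p; apply/asboolP; exists M.
case: (ex_minnP exp) => p /andP[pr_p /asboolP[M1 DM1 M1p]] minp.
exists p; split=> //.
have [M2 [DM2 M21 M2p]] := same_residue_prime null irrD Dfin Rfin maxD DM1 pr_p M1p.
have [f fP] := maximal_functional null pr_p (maxD _ DM1) M1p.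
have [g gP] := maximal_functional null pr_p (maxD _ DM2) M2p.
have [a M2a nM1a] := maximal_ideal_notin (maxD _ DM1) (maxD _ DM2) M21.
have [b M1b nM2b] := maximal_ideal_notin (maxD _ DM2) (maxD _ DM1) (nesym M21).
have fa : f a != 0 by apply/eqP => /fP.
have gb : g b != 0 by apply/eqP => /gP.
have ga : g a = 0 by apply/gP.
have fb : f b = 0 by apply/fP.
have Dp : `I_p.+1 #<= D.
  apply: irredundant_card_ge irrD _ => M v d DM dp Mvd.
  have [q pr_q Mq] := maximal_null_prime null Rfin (maxD _ DM).
  have pq : (p <= q)%N by apply: minp; rewrite /resp pr_q; apply/asboolP; exists M.
  apply: (ideal_Mn_coprime (maxD _ DM).1.1 (prime_gt0 pr_q) _ (Mq v) Mvd).
  exact: prime_coprime_lt dp.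
have covP := pencil_cover null pr_p fa ga gb.
have minP : minimal_cover (pencil f g).
  split=> // E /minD.2; apply: card_le_trans.
  exact: card_le_trans (pencil_card_le f g) Dp.
have fg_inj x : f x = 0 -> g x = 0 -> x = 0.
  move=> fx gx; have : (\bigcap_(L in pencil f g) L) x.
    move=> _ [k _ <-]; rewrite /pencil_line /=.
    by case: k => // k; rewrite fx gx mul0rn.
  by rewrite (elementary_bigcap0 elR minP).
pose phi x : ('Z_p * 'Z_p)%type := (f x, g x).
have phiB : zmod_morphism phi by move=> x y; rewrite /phi !raddfB.
pose phiM := GRing.isZmodMorphism.Build R ('Z_p * 'Z_p)%type phi phiB.
pose phiA : {additive R -> ('Z_p * 'Z_p)%type} := HB.pack phi phiM.
exists phiA; rewrite -setTT_bijective; split=> //.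
  move=> x y _ _ [fxy gxy]; apply/eqP; rewrite -subr_eq0; apply/eqP.
  by apply: fg_inj; rewrite raddfB ?fxy ?gxy subrr.
move=> [u v] _; exists (a *+ (u / f a : 'Z_p) + b *+ (v / g b : 'Z_p)) => //.
change (phi (a *+ (u / f a : 'Z_p) + b *+ (v / g b : 'Z_p)) = (u, v)).
rewrite /phi !raddfD !raddfMn ga fb !mul0rn addr0 add0r.
by congr pair; rewrite -mulr_natr natr_Zp mulrC divrK ?Zp_prime_unit.
Qed.

Theorem theorem1p2 (R : rngType) :
  (eta_elementary R <->
     (forall r s : R, r ** s = 0) /\
     (exists p : nat, prime p /\ additive_iso R ('Z_p * 'Z_p)%type)) /\
  (forall p : nat,
     (forall r s : R, r ** s = 0) -> prime p ->
     additive_iso R ('Z_p * 'Z_p)%type ->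
     ecard_eq (eta R) (ecard_of_nat p.+1)).
Proof.
have plane p : prime p -> additive_iso R ('Z_p * 'Z_p)%type ->
    exists f g : {additive R -> 'Z_p},
    (forall x, f x = 0 -> g x = 0 -> x = 0) /\
    exists a b, [/\ f a != 0, g a = 0 & g b != 0].
  move=> pr_p [phi [psi phiK psiK]].
  pose f : {additive R -> 'Z_p} := fst \o phi.
  pose g : {additive R -> 'Z_p} := snd \o phi.
  exists f, g; split.
    move=> x fx gx; apply: (can_inj phiK); rewrite raddf0.
    by move: fx gx; rewrite /f /g /=; case: (phi x) => u v /= -> ->.
  exists (psi (1, 0)), (psi (0, 1)).
  have fE u : f (psi u) = u.1 by rewrite -[in RHS](psiK u).
  have gE u : g (psi u) = u.2 by rewrite -[in RHS](psiK u).
  by rewrite fE !gE; split=> //; exact: oner_neq0.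
split; last first.
  move=> p null pr_p /(plane p pr_p)[f [g [fg_inj [a [b [fa ga gb]]]]]].
  exact: (plane_eta null pr_p fg_inj fa ga gb).
split; first exact: elementary_plane.
move=> [null [p [pr_p /(plane p pr_p)[f [g [fg_inj [a [b [fa ga gb]]]]]]]]].
have covP := pencil_cover null pr_p fa ga gb.
split.
  exists (pencil f g) => //.
  exact: card_le_finite (pencil_card_le f g) (finite_II _).
move=> I I0; have nocov := plane_quot_nocover pr_p fg_inj I0.
have := plane_eta null pr_p fg_inj fa ga gb; have := etaP (rng_quot I).
case: (eta _) => [U B [[E covE _] _]|_]; first by case: nocov; exists E.
by case: (eta R).
Qed.
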